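(* Let $L$ be a cyclic infinite dimensional Leibniz algebra over a field $F$. Then the group of all automorphisms of $L$ is isomorphic to the multiplicative group of the field $F$.
   Context: A (left) Leibniz algebra over a field $F$ is an $F$-vector space $L$ with a bilinear operation $[\cdot,\cdot]$ satisfying $[a,[b,c]]=[[a,b],c]+[b,[a,c]]$ for all $a,b,c\in L$. It is cyclic if it is generated, as an algebra, by a single element. An automorphism of $L$ is a bijective $F$-linear map $f:L\to L$ with $f([a,b])=[f(a),f(b)]$ for all $a,b\in L$; automorphisms form a group under composition. *)

(* Defs.v *)
From HB Require Import structures.
From mathcomp Require Import all_boot all_order all_algebra.
From mathcomp Require Import boolp classical_sets.

Set Implicit Arguments.
Unset Strict Implicit.
Unset Printing Implicit Defensive.

Import GRing.Theory.
Local Open Scope ring_scope.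

(* Left Leibniz algebras: every left multiplication is a derivation. *)
HB.mixin Record Lmodule_isLeibniz (F : fieldType) L of GRing.Lmodule F L := {
  bracket : L -> L -> L;
  bracket_is_bilinear : bilinear_for *:%R *:%R bracket;
  bracket_leibniz : forall a b c : L,
    bracket a (bracket b c) = bracket (bracket a b) c + bracket b (bracket a c)
}.

#[short(type="leibnizAlgType")]
HB.structure Definition LeibnizAlgebra (F : fieldType) :=
  {L of Lmodule_isLeibniz F L & GRing.Lmodule F L}.

HB.instance Definition _ (F : fieldType) (L : leibnizAlgType F) :=
  bilinear_isBilinear.Build F L L L _ _ (@bracket F L) bracket_is_bilinear.

Definition is_subalgebra (F : fieldType) (L : leibnizAlgType F) (S : set L) :=
  [/\ S 0,
      forall (k : F) (x y : L), S x -> S y -> S (k *: x + y)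
    & forall x y : L, S x -> S y -> S (bracket x y)].

Definition generated_subalgebra (F : fieldType) (L : leibnizAlgType F)
  (X : set L) : set L := smallest (@is_subalgebra F L) X.

Definition is_cyclic (F : fieldType) (L : leibnizAlgType F) :=
  exists a : L, generated_subalgebra [set a]%classic = [set: L]%classic.

Definition finite_dimensional (F : fieldType) (V : lmodType F) :=
  exists (n : nat) (e : 'I_n -> V),
    forall v : V, exists c : 'I_n -> F, v = \sum_(i < n) c i *: e i.

Definition infinite_dimensional (F : fieldType) (V : lmodType F) :=
  ~ finite_dimensional V.

Record leibnizAut (F : fieldType) (L : leibnizAlgType F) := LeibnizAut {
  aut_fun :> L -> L;
  aut_is_linear : linear aut_fun;
  aut_bijective : bijective aut_fun;
  aut_bracket : {morph aut_fun : x y / bracket x y}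
}.

(* [groupType] requires a [choiceType], here obtained from classical choice. *)
HB.instance Definition _ (F : fieldType) (L : leibnizAlgType F) :=
  gen_eqMixin (leibnizAut L).
HB.instance Definition _ (F : fieldType) (L : leibnizAlgType F) :=
  gen_choiceMixin (leibnizAut L).

Section AutGroup.
Context (F : fieldType) (L : leibnizAlgType F).
Implicit Types f g h : leibnizAut L.

Lemma leibnizAutP f g : f =1 g -> f = g.
Proof.
case: f g => [f lf bf mf] [g lg bg mg] /= /funext efg.
by subst g; congr LeibnizAut; exact: Prop_irrelevance.
Qed.

Lemma aut1_linear : linear (@idfun L). Proof. by []. Qed.
Lemma aut1_bijective : bijective (@idfun L).
Proof. by exists idfun. Qed.
Lemma aut1_bracket : {morph @idfun L : x y / bracket x y}. Proof. by []. Qed.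

Definition aut1 : leibnizAut L :=
  LeibnizAut aut1_linear aut1_bijective aut1_bracket.

Lemma autM_linear f g : linear (f \o g).
Proof. by move=> k x y; rewrite /= !aut_is_linear. Qed.
Lemma autM_bijective f g : bijective (f \o g).
Proof. exact: bij_comp (aut_bijective f) (aut_bijective g). Qed.
Lemma autM_bracket f g : {morph f \o g : x y / bracket x y}.
Proof. by move=> x y; rewrite /= !aut_bracket. Qed.

Definition autM f g : leibnizAut L :=
  LeibnizAut (autM_linear f g) (autM_bijective f g) (autM_bracket f g).

Lemma aut_inv_exists f : exists g : L -> L, cancel f g /\ cancel g f.
Proof. by have [g fK gK] := aut_bijective f; exists g. Qed.

Definition aut_inv f : L -> L := sval (cid (aut_inv_exists f)).

Lemma aut_invK f : cancel f (aut_inv f).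
Proof. by rewrite /aut_inv; case: cid => g []. Qed.
Lemma aut_Kinv f : cancel (aut_inv f) f.
Proof. by rewrite /aut_inv; case: cid => g []. Qed.

Lemma autV_linear f : linear (aut_inv f).
Proof.
by move=> k x y; apply: (can_inj (aut_invK f)); rewrite aut_is_linear !aut_Kinv.
Qed.
Lemma autV_bijective f : bijective (aut_inv f).
Proof. by exists f; [exact: aut_Kinv | exact: aut_invK]. Qed.
Lemma autV_bracket f : {morph aut_inv f : x y / bracket x y}.
Proof.
by move=> x y; apply: (can_inj (aut_invK f)); rewrite aut_bracket !aut_Kinv.
Qed.

Definition autV f : leibnizAut L :=
  LeibnizAut (autV_linear f) (autV_bijective f) (autV_bracket f).

Lemma autMA : associative autM.
Proof. by move=> f g h; exact: leibnizAutP. Qed.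
Lemma aut1M : left_id aut1 autM.
Proof. by move=> f; exact: leibnizAutP. Qed.
Lemma autM1 : right_id aut1 autM.
Proof. by move=> f; exact: leibnizAutP. Qed.
Lemma autVM : left_inverse aut1 autV autM.
Proof. by move=> f; apply: leibnizAutP => x /=; rewrite aut_invK. Qed.
Lemma autMV : right_inverse aut1 autV autM.
Proof. by move=> f; apply: leibnizAutP => x /=; rewrite aut_Kinv. Qed.

HB.instance Definition _ :=
  isGroup.Build (leibnizAut L) autMA aut1M autM1 autVM autMV.

End AutGroup.

(* The library's [{unit R}] is only available for finite rings. *)
Record mulGroup (F : fieldType) := MulGroup {
  mulGroup_val : F;
  mulGroup_neq0 : mulGroup_val != 0
}.

HB.instance Definition _ (F : fieldType) := [isSub for @mulGroup_val F].
HB.instance Definition _ (F : fieldType) := [Choice of mulGroup F by <:].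

Section FieldGroup.
Context (F : fieldType).
Implicit Types x y : mulGroup F.

Definition mulGroup1 : mulGroup F := MulGroup (oner_neq0 F).

Lemma mulGroupM_neq0 x y : val x * val y != 0.
Proof. by rewrite mulf_neq0 ?mulGroup_neq0. Qed.
Definition mulGroupM x y : mulGroup F := MulGroup (mulGroupM_neq0 x y).

Lemma mulGroupV_neq0 x : (val x)^-1 != 0.
Proof. by rewrite invr_neq0 ?mulGroup_neq0. Qed.
Definition mulGroupV x : mulGroup F := MulGroup (mulGroupV_neq0 x).

Lemma mulGroupMA : associative mulGroupM.
Proof. by move=> x y z; apply: val_inj; rewrite /= mulrA. Qed.
Lemma mulGroup1M : left_id mulGroup1 mulGroupM.
Proof. by move=> x; apply: val_inj; rewrite /= mul1r. Qed.
Lemma mulGroupM1 : right_id mulGroup1 mulGroupM.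
Proof. by move=> x; apply: val_inj; rewrite /= mulr1. Qed.
Lemma mulGroupVM : left_inverse mulGroup1 mulGroupV mulGroupM.
Proof. by move=> x; apply: val_inj; rewrite /= mulVf ?mulGroup_neq0. Qed.
Lemma mulGroupMV : right_inverse mulGroup1 mulGroupV mulGroupM.
Proof. by move=> x; apply: val_inj; rewrite /= mulfV ?mulGroup_neq0. Qed.

HB.instance Definition _ := isGroup.Build (mulGroup F)
  mulGroupMA mulGroup1M mulGroupM1 mulGroupVM mulGroupMV.

End FieldGroup.

Definition group_isomorphic (G H : groupType) :=
  exists2 phi : G -> H, bijective phi & {morph phi : x y / (x * y)%g}.

(* Main.v *)
Require Import Defs.
From mathcomp Require Import all_boot all_order all_algebra.
From HB Require Import structures.
From mathcomp Require Import boolp classical_sets.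
From mathcomp Require Import boolp classical_sets.

(** Let [a] generate [L] and let [T] be the left multiplication by [a]. The
Leibniz identity forces [T x] to act on the left by zero for every [x] of the
form [p(T) a], so the elements [p(T) a], with [p] a polynomial, already form a
subalgebra; hence [p |-> p(T) a] maps [{poly F}] onto [L]. Its kernel is an
ideal of [{poly F}], and a nonzero ideal has finite codimension, so it is a
bijection when [L] has infinite dimension. Thus [L] is the space of polynomials
with the bracket [p, q |-> p(0) X q] ([bracket_poly_eval], [poly_eval_bij]).

In this model, an endomorphism that sends the generator to [p], with constant
term [l], sends [q] to [q(l X) p] ([aut_poly_eval]). Its image consists of
multiples of [p], so if it is surjective then [p] divides [1] and [p] is the
constant [l], which is nonzero ([aut_generator]). Conversely, for each [l != 0],
[q |-> l q(l X)] is an automorphism ([scale_aut]). The isomorphism sends an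
automorphism to the eigenvalue [l] of the generator. *)

Set Implicit Arguments.
Unset Strict Implicit.
Unset Printing Implicit Defensive.

Import GRing.Theory.
Local Open Scope ring_scope.

(** * Substitution of a multiple of the variable *)

Section Dilation.
Context (F : fieldType).
Implicit Types (l m : F) (p q : {poly F}).

Definition dilate l p : {poly F} := p \Po (l *: 'X).

Lemma dilateD l : {morph dilate l : p q / p + q}.
Proof. by move=> p q; rewrite /dilate comp_polyD. Qed.

Lemma dilateZ l c p : dilate l (c *: p) = c *: dilate l p.
Proof. by rewrite /dilate comp_polyZ. Qed.

Lemma dilateC l c : dilate l c%:P = c%:P.
Proof. by rewrite /dilate comp_polyC. Qed.

Lemma dilateMX l p : dilate l (p * 'X) = l *: (dilate l p * 'X).
Proof. by rewrite /dilate comp_polyM comp_polyX scalerAr. Qed.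

Lemma coef0_dilate l p : (dilate l p)`_0 = p`_0.
Proof.
by rewrite -!horner_coef0 /dilate horner_comp hornerZ hornerX mulr0.
Qed.

Lemma dilateK l : l != 0 -> cancel (dilate l) (dilate l^-1).
Proof.
move=> l0 p; rewrite /dilate -comp_polyA comp_polyZ comp_polyX scalerA.
by rewrite mulfV // scale1r comp_polyXr.
Qed.

End Dilation.

(** * The polynomial model of a cyclic algebra *)

Section PolynomialModel.
Context (F : fieldType) (L : leibnizAlgType F) (a : L).
Implicit Types (p q r : {poly F}) (x y z : L) (f g : leibnizAut L).

Definition lmul x : L := bracket a x.

Lemma bracket_linear_l y : linear (bracket ^~ y : L -> L).
Proof. by move=> k u v; rewrite (bracket_is_bilinear (s := L)).1. Qed.

Lemma bracket_linear_r x : linear (bracket x : L -> L).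
Proof. by move=> k u v; rewrite (bracket_is_bilinear (s := L)).2. Qed.

HB.instance Definition _ :=
  GRing.isLinear.Build F L L _ lmul (bracket_linear_r a).

(** This is [p(T) a] with [T = lmul]; evaluating [p] at [T] directly would require
the ring of endomorphisms of [L]. *)
Definition poly_eval p : L := \sum_(i < size p) p`_i *: iter i lmul a.

Lemma poly_eval_widen n p : (size p <= n)%N ->
  poly_eval p = \sum_(i < n) p`_i *: iter i lmul a.
Proof.
move=> le_pn; rewrite /poly_eval (big_ord_widen n (fun i => p`_i *: iter i lmul a)) //.
rewrite big_mkcond /=; apply: eq_bigr => i _; case: ltnP => // le_pi.
by rewrite nth_default // scale0r.
Qed.

Lemma poly_eval_is_linear : linear poly_eval.
Proof.
move=> k p q; pose n := maxn (size p) (size q).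
have le_pn : (size p <= n)%N by rewrite leq_maxl.
have le_qn : (size q <= n)%N by rewrite leq_maxr.
rewrite (poly_eval_widen le_pn) (poly_eval_widen le_qn) (@poly_eval_widen n).
  rewrite scaler_sumr -big_split /=; apply: eq_bigr => i _.
  by rewrite coefD coefZ scalerDl scalerA.
by rewrite (leq_trans (size_polyD _ _)) // geq_max le_qn (leq_trans (size_scale_leq _ _)).
Qed.

HB.instance Definition _ :=
  GRing.isLinear.Build F {poly F} L _ poly_eval poly_eval_is_linear.

Lemma poly_evalC c : poly_eval c%:P = c *: a.
Proof.
by rewrite (poly_eval_widen (size_polyC_leq1 c)) big_ord1 coefC.
Qed.

Lemma poly_evalMX p : poly_eval (p * 'X) = lmul (poly_eval p).
Proof.
rewrite (@poly_eval_widen (size p).+1); last first.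
  by rewrite (leq_trans (size_polyMleq _ _)) // size_polyX addn2.
rewrite big_ord_recl coefMX /= scale0r add0r linear_sum.
by apply: eq_bigr => i _; rewrite coefMX /= linearZ.
Qed.

Lemma bracket_lmul w z : bracket (lmul w) z = lmul (bracket w z) - bracket w (lmul z).
Proof. by rewrite /lmul bracket_leibniz addrK. Qed.

(** For [p = 1] this is the Leibniz identity for [a], [a], [z], which reads
[T (T z) = bracket (T a) z + T (T z)]. Each further factor [X] follows from
[bracket_lmul]. *)
Lemma bracket_poly_evalMX p z : bracket (poly_eval (p * 'X)) z = 0.
Proof.
elim/poly_ind: p z => [|p c IHp] z; first by rewrite mul0r linear0 linear0l.
rewrite poly_evalMX linearD linearD /= poly_evalC linearZ /= addrC.
rewrite bracket_linear_l (bracket_lmul a) subrr scaler0 add0r.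
by rewrite bracket_lmul !IHp linear0 subrr.
Qed.

Lemma bracket_poly_eval p q :
  bracket (poly_eval p) (poly_eval q) = p`_0 *: poly_eval (q * 'X).
Proof.
elim/poly_ind: p => [|p c _].
  by rewrite linear0 linear0l coef0 scale0r.
rewrite linearD /= poly_evalC addrC bracket_linear_l bracket_poly_evalMX addr0.
by rewrite coefD coefMX coefC add0r poly_evalMX.
Qed.

(** The range of [poly_eval] contains [a] and is closed under the bracket by
[bracket_poly_eval], so it is a subalgebra containing the generator. *)
Lemma poly_eval_surj :
  generated_subalgebra [set a]%classic = [set: L]%classic ->
  forall x, exists p, poly_eval p = x.
Proof.
move=> gen_a x; suff [p _ <-] : range poly_eval x by exists p.
have : generated_subalgebra [set a]%classic x by rewrite gen_a.
apply: smallest_sub => [|y ->] {x}.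
  split.
  - by exists 0; rewrite // linear0.
  - by move=> k x y [p _ <-] [q _ <-]; exists (k *: p + q); rewrite ?linearP.
  - move=> x y [p _ <-] [q _ <-]; exists (p`_0 *: (q * 'X)) => //.
    by rewrite linearZ bracket_poly_eval.
by exists 1%:P; rewrite // poly_evalC scale1r.
Qed.

Lemma poly_eval_ker_ideal p q : poly_eval p = 0 -> poly_eval (q * p) = 0.
Proof.
move=> p0; elim/poly_ind: q => [|q c IHq]; first by rewrite mul0r linear0.
rewrite mulrDl mul_polyC linearD linearZ /= p0 scaler0 addr0.
by rewrite mulrAC poly_evalMX IHq linear0.
Qed.

(** If [p != 0] were in the kernel, then by Euclidean division by [p] the
algebra would be spanned by the finitely many [T^i a] with [i < size p]. *)
Lemma poly_eval_inj :
  generated_subalgebra [set a]%classic = [set: L]%classic ->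
  infinite_dimensional L -> injective poly_eval.
Proof.
move=> gen_a infL; apply: raddf_inj => p p0; apply/eqP/negP => /negP nz_p.
apply: infL; exists (size p), (fun i : 'I_(size p) => iter i lmul a) => x.
have [q <-] := poly_eval_surj gen_a x.
exists (fun i => (q %% p)`_i); rewrite {1}(divp_eq q p) linearD /=.
by rewrite poly_eval_ker_ideal // add0r -poly_eval_widen // ltnW ?ltn_modp.
Qed.

Lemma poly_eval_bij :
  generated_subalgebra [set a]%classic = [set: L]%classic ->
  infinite_dimensional L -> bijective poly_eval.
Proof.
move=> gen_a infL; have surj := poly_eval_surj gen_a.
have K x : poly_eval (sval (cid (surj x))) = x by case: cid.
exists (fun x => sval (cid (surj x))) => // p.
by apply: (poly_eval_inj gen_a infL).
Qed.

(** * Automorphisms in the polynomial model *)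

HB.instance Definition _ f :=
  GRing.isLinear.Build F L L _ (aut_fun f) (aut_is_linear f).

(** Since [f] maps [T x] to [bracket (f a) (f x)] and [poly_eval p] acts on the
left as [p`_0 *: T], a factor [X] in [q] becomes a factor [p`_0 *: X]. *)
Lemma aut_poly_eval f p q : f a = poly_eval p ->
  f (poly_eval q) = poly_eval (dilate p`_0 q * p).
Proof.
move=> fa; elim/poly_ind: q => [|q c IHq].
  by rewrite /dilate comp_poly0 mul0r !linear0.
rewrite dilateD dilateMX dilateC mulrDl linearD [LHS]linearD.
rewrite /= poly_evalMX poly_evalC /lmul aut_bracket fa IHq bracket_poly_eval.
have -> : f (c *: a) = c *: poly_eval p by rewrite linearZ /= fa.
by rewrite linearD mul_polyC -scalerAl mulrAC !linearZ.
Qed.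

Lemma aut_generator f :
  generated_subalgebra [set a]%classic = [set: L]%classic ->
  infinite_dimensional L -> exists2 l : F, l != 0 & f a = l *: a.
Proof.
move=> gen_a infL; have [p fa] := poly_eval_surj gen_a (f a).
have [g _ gK] := aut_bijective f.
have [q qE] := poly_eval_surj gen_a (g a).
(* a preimage of the generator gives an inverse of p among the polynomials *)
have qp1 : dilate p`_0 q * p = 1.
  apply: (poly_eval_inj gen_a infL).
  by rewrite -(aut_poly_eval _ (esym fa)) qE gK -[1]/(1%:P) poly_evalC scale1r.
have : p %| 1 by rewrite -qp1 dvdp_mull.
rewrite dvdp1 => /size_poly1P[c c0 pE]; exists c => //.
by rewrite -fa pE poly_evalC.
Qed.

Lemma aut_ext f g :
  generated_subalgebra [set a]%classic = [set: L]%classic ->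
  f a = g a -> f = g.
Proof.
move=> gen_a fga; apply: leibnizAutP => x.
have [q <-] := poly_eval_surj gen_a x; have [p fa] := poly_eval_surj gen_a (f a).
by rewrite (@aut_poly_eval f p) // (@aut_poly_eval g p) // -fga.
Qed.

(** In the polynomial model this is [q |-> l *: dilate l q]. It respects the
bracket because both sides send [p], [q] to [l^2 p(0) X q(l X)]. *)
Lemma scale_aut (l : F) :
  generated_subalgebra [set a]%classic = [set: L]%classic ->
  infinite_dimensional L -> l != 0 -> exists f, f a = l *: a.
Proof.
move=> gen_a infL l0; have [coord evalK coordK] := poly_eval_bij gen_a infL.
pose h m x := poly_eval (m *: dilate m (coord x)).
have hE m p : h m (poly_eval p) = poly_eval (m *: dilate m p).
  by rewrite /h evalK.
have hlin : linear (h l).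
  move=> k x y; rewrite -(coordK x) -(coordK y) -linearP !hE -linearP /=.
  by rewrite dilateD dilateZ scalerDr !scalerA mulrC.
have hK m : m != 0 -> cancel (h m) (h m^-1).
  move=> m0 x; rewrite -(coordK x) !hE dilateZ scalerA mulVf // scale1r.
  by rewrite dilateK.
have hbij : bijective (h l).
  by exists (h l^-1); [exact: hK | rewrite -{2}(invrK l); apply: hK; rewrite invr_neq0].
have hmorph : {morph h l : x y / bracket x y}.
  move=> x y; rewrite -(coordK x) -(coordK y) bracket_poly_eval -linearZ !hE.
  rewrite dilateZ dilateMX bracket_poly_eval coefZ coef0_dilate.
  by rewrite -scalerAl !linearZ /= !scalerA mulrC.
exists (LeibnizAut hlin hbij hmorph) => /=.
rewrite -{1}(scale1r a) -poly_evalC hE dilateC linearZ /=.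
by rewrite poly_evalC scale1r.
Qed.

End PolynomialModel.

Theorem mainTheorem2 (F : fieldType) (L : leibnizAlgType F)
  (L_cyclic : is_cyclic L) (L_infdim : infinite_dimensional L) :
  group_isomorphic (leibnizAut L) (mulGroup F).
Proof.
have [a gen_a] := L_cyclic.
have a_inj : injective (fun l : F => l *: a).
  move=> l m; rewrite -!(poly_evalC a).
  by move/(poly_eval_inj gen_a L_infdim)/polyC_inj.
have eigen (f : leibnizAut L) : {l : mulGroup F | f a = val l *: a}.
  apply: cid; have [l l0 fa] := aut_generator f gen_a L_infdim.
  by exists (MulGroup l0).
have aut (l : mulGroup F) : {f : leibnizAut L | f a = val l *: a}.
  exact/cid/(scale_aut gen_a L_infdim)/mulGroup_neq0.
exists (fun f => sval (eigen f)).
  exists (fun l => sval (aut l)) => [f|l].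
    by apply: (aut_ext gen_a); case: (aut _) => g /= ->; case: (eigen _).
  by apply/val_inj/a_inj; case: (eigen _) => m /= <-; case: (aut _).
move=> f g; apply/val_inj/a_inj; case: (eigen _) => n /= <-.
case: (eigen f) => l fa; case: (eigen g) => m ga /=.
by rewrite ga linearZ /= fa scalerA mulrC.
Qed.
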